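(* Let $\mathcal H$ be a separable Hilbert space, let $\{f_i\}_{i\in I}$ and $\{g_i\}_{i\in I}$ be woven frames for $\mathcal H$, and let $T$ be an invertible bounded linear operator on $\mathcal H$. Then $\{Tf_i\}_{i\in I}$ and $\{Tg_i\}_{i\in I}$ are woven frames for $\mathcal H$.
   Context: The index set $I$ is finite or countably infinite. A family $\{f_i\}_{i\in I}$ in $\mathcal H$ is a frame for $\mathcal H$ if there are constants $A,B>0$ with $A\|f\|^2\le\sum_{i\in I}|\langle f,f_i\rangle|^2\le B\|f\|^2$ for all $f\in\mathcal H$. Two frames $\{f_i\}_{i\in I}$ and $\{g_i\}_{i\in I}$ for $\mathcal H$ are woven if for every $\sigma\subseteq I$ the family (weaving) $\{f_i\}_{i\in\sigma}\cup\{g_i\}_{i\in\sigma^c}$ (with $\sigma^c=I\setminus\sigma$, counted with multiplicity) is a frame for $\mathcal H$. By a known result (Bemrose, Casazza, Gröchenig, Lammers, Lynch, ''Weaving frames'') this is equivalent to the existence of universal frame bounds, i.e. constants $0<A\le B$ that are frame bounds for every weaving simultaneously. *)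

(* Defs.v *)
From HB Require Import structures.
From mathcomp Require Import all_boot all_order all_algebra.
From mathcomp Require Import complex.
From mathcomp Require Import all_classical all_reals all_analysis.

Set Implicit Arguments.
Unset Strict Implicit.
Unset Printing Implicit Defensive.

Import Order.TTheory GRing.Theory Num.Theory.
Import numFieldNormedType.Exports.

Local Open Scope classical_set_scope.
Local Open Scope ring_scope.

(* A Hilbert space is real or complex; both cases are treated uniformly by
   indexing the scalar field by [scalar_kind]. *)
Variant scalar_kind := RealScalars | ComplexScalars.

Definition scalar_field (R : realType) (k : scalar_kind) : numFieldType :=
  if k is RealScalars then R : numFieldType else R[i] : numFieldType.

Definition conj_scalar (R : realType) (k : scalar_kind) :
    scalar_field R k -> scalar_field R k :=
  match k with
  | RealScalars => fun x => x
  | ComplexScalars => fun z => conjc z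
  end.

Definition re_scalar (R : realType) (k : scalar_kind) : scalar_field R k -> R :=
  match k with
  | RealScalars => fun x => x
  | ComplexScalars => fun z => complex.Re z
  end.

(* The inner product is linear in its first argument and conjugate-linear in
   the second one. *)
HB.mixin Record CompleteNormedModule_isHilbert (R : realType)
    (k : scalar_kind) H of CompleteNormedModule (scalar_field R k) H := {
  inner : {dot H for @conj_scalar R k} ;
  normr_inner : forall x : H, `|x| ^+ 2 = inner x x
}.

#[short(type="hilbertType")]
HB.structure Definition Hilbert (R : realType) (k : scalar_kind) :=
  {H of CompleteNormedModule_isHilbert R k H &
        CompleteNormedModule (scalar_field R k) H}.

(* In MathComp-Analysis a norm takes its (real, nonnegative) values in the
   scalar field; [rnorm] is the same number seen in [R]. *)
Definition rnorm (R : realType) (k : scalar_kind)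
    (V : normedZmodType (scalar_field R k)) (x : V) : R :=
  re_scalar (`|x| : scalar_field R k).

Definition separable (T : topologicalType) : Prop :=
  exists2 D : set T, countable D & dense D.

Section Frames.
Context (R : realType) (k : scalar_kind) (H : hilbertType R k) (I : countType).
Implicit Types f g : I -> H.

(* The sum is taken in [\bar R], so that the upper bound also expresses its
   convergence. *)
Definition frame f : Prop :=
  exists A B : R, [/\ 0 < A, 0 < B & forall h : H,
    ((A * rnorm h ^+ 2)%:E
       <= \esum_(i in [set: I]) (rnorm (inner h (f i)) ^+ 2)%:E
       <= (B * rnorm h ^+ 2)%:E)%E].

Definition weaving f g (sigma : set I) : I -> H :=
  fun i => if i \in sigma then f i else g i.

Definition woven f g : Prop :=
  [/\ frame f, frame g & forall sigma : set I, frame (weaving f g sigma)].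

End Frames.

Definition bounded_operator (R : realType) (k : scalar_kind)
    (H : hilbertType R k) (T : {linear H -> H}) : Prop :=
  exists M : R, forall x : H, rnorm (T x) <= M * rnorm x.

(* Main.v *)
Require Import Defs.
From HB Require Import structures.
From mathcomp Require Import all_boot all_order all_algebra.
From mathcomp Require Import complex.
From mathcomp Require Import all_classical all_reals all_analysis.
From mathcomp Require Import ring lra.

(** Let S be the adjoint of T, so that <h, T f_i> = <S h, f_i>. The frame sum of
    {T f_i} at h is then the frame sum of {f_i} at S h, and the frame bounds
    of {f_i} become frame bounds of {T f_i} as soon as c |h| <= |S h| <= M |h|
    for some c > 0. Since T applied to a weaving of f and g is the weaving of
    T f and T g along the same set, weaving by weaving this gives the theorem.

    The upper estimate for S is the boundedness of T. The lower one
    ([adjoint_bounded_below]) comes from the surjectivity of T: on the vectors h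
    with |S h| <= 1, each functional <x, .> is bounded, for x = T y gives
    |<T y, h>| = |<y, S h>| <= |y|; by the uniform boundedness principle these
    h have bounded norms.

    Two results on Hilbert spaces carry the argument: the representation
    of bounded functionals ([riesz]), from which S is obtained, and
    the uniform boundedness principle ([uniform_boundedness]). Both only involve
    the real structure: H with the real part of its inner product is a real
    Hilbert space, which treats real and complex scalars at once. An identity
    between real parts extends to the full inner products by testing it on
    scalar multiples ([conj_linear_re_inj]). *)

Set Implicit Arguments.
Unset Strict Implicit.
Unset Printing Implicit Defensive.

Import Order.TTheory GRing.Theory Num.Theory.
Import numFieldNormedType.Exports.

Local Open Scope classical_set_scope.
Local Open Scope ring_scope.

(** * Real numbers inside the scalar field *)

Definition real_scalar (R : realType) (k : scalar_kind) :
    R -> scalar_field R k :=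
  match k with
  | RealScalars => fun r => r
  | ComplexScalars => fun r => r%:C%C
  end.
Arguments real_scalar {R} k r.

Section Scalars.
Context (R : realType) (k : scalar_kind).
Implicit Types (r : R) (a b : scalar_field R k).

Lemma real_scalarK : cancel (@real_scalar R k) (@re_scalar R k).
Proof. by case: k. Qed.

Lemma re_scalarD a b : re_scalar (a + b) = re_scalar a + re_scalar b.
Proof. by case: k a b => // [[? ?] [? ?]]. Qed.

Lemma re_scalarB a b : re_scalar (a - b) = re_scalar a - re_scalar b.
Proof. by case: k a b => // [[? ?] [? ?]]. Qed.

Lemma re_scalarM r a : re_scalar (real_scalar k r * a) = r * re_scalar a.
Proof. by case: k a => // -[x y] /=; rewrite mul0r subr0. Qed.

Lemma re_scalar_conj a : re_scalar (conj_scalar a) = re_scalar a.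
Proof. by case: k a => // -[? ?]. Qed.

Lemma real_scalarD r s :
  real_scalar k (r + s) = real_scalar k r + real_scalar k s.
Proof. by case: k => //=; rewrite rmorphD. Qed.

Lemma real_scalar0 : real_scalar k (0 : R) = 0.
Proof. by case: k. Qed.

Lemma ge0_real_scalarK a : 0 <= a -> real_scalar k (re_scalar a) = a.
Proof. by case: k a => // -[x y]; rewrite lecE /= => /andP[/eqP -> _]. Qed.

Lemma ler_real_scalar r s : (real_scalar k r <= real_scalar k s) = (r <= s).
Proof. by case: k => //=; rewrite lecR. Qed.

Lemma ltr_real_scalar r s : (real_scalar k r < real_scalar k s) = (r < s).
Proof. by case: k => //=; rewrite ltcR. Qed.

Lemma norm_real_scalar r : `|real_scalar k r| = real_scalar k `|r|.
Proof. by case: k => //=; rewrite normc_def /= expr0n addr0 sqrtr_sqr. Qed.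

Lemma re_mul_conj_eq0 a : re_scalar (conj_scalar a * a) = 0 -> a = 0.
Proof.
case: k a => [x /eqP|[x y] /= h]; first by rewrite mulf_eq0 orbb => /eqP.
have /eqP : x ^+ 2 + y ^+ 2 = 0 by rewrite -h; ring.
by rewrite paddr_eq0 ?sqr_ge0 // !sqrf_eq0 => /andP[/eqP -> /eqP ->].
Qed.
End Scalars.

(** * The real-valued norm *)

Section Norm.
Context (R : realType) (k : scalar_kind).

Lemma rnormK (V : normedZmodType (scalar_field R k)) (x : V) :
  real_scalar k (rnorm x) = `|x|.
Proof. by rewrite ge0_real_scalarK. Qed.

Lemma rnorm0 (V : normedZmodType (scalar_field R k)) : rnorm (0 : V) = 0.
Proof. by rewrite /rnorm normr0 -(@real_scalar0 R k) real_scalarK. Qed.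

Lemma rnorm_ge0 (V : normedZmodType (scalar_field R k)) (x : V) : 0 <= rnorm x.
Proof.
have : 0 <= `|x| by [].
by rewrite -rnormK -(ler_real_scalar k) real_scalar0.
Qed.

Lemma rnormD (V : normedZmodType (scalar_field R k)) (x y : V) :
  rnorm (x + y) <= rnorm x + rnorm y.
Proof. by rewrite -(ler_real_scalar k) real_scalarD !rnormK ler_normD. Qed.

Lemma rdistC (V : normedZmodType (scalar_field R k)) (x y : V) :
  rnorm (x - y) = rnorm (y - x).
Proof. by rewrite /rnorm distrC. Qed.

Lemma rnormZ (V : normedModType (scalar_field R k)) (r : R) (x : V) :
  rnorm (real_scalar k r *: x) = `|r| * rnorm x.
Proof. by rewrite /rnorm normrZ norm_real_scalar re_scalarM. Qed.
End Norm.

Section Complete.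
Context (R : realType) (k : scalar_kind)
        (V : completeNormedModType (scalar_field R k)).

(** Completeness is about radii in the scalar field, but a positive scalar is
    a real number, so real radii suffice. *)
Lemma rnorm_complete (u : nat -> V) :
  (forall e : R, 0 < e ->
     exists N, forall m n, (N <= m)%N -> (N <= n)%N -> rnorm (u m - u n) < e) ->
  exists l, forall e : R, 0 < e ->
     exists N, forall n, (N <= n)%N -> rnorm (l - u n) < e.
Proof.
move=> cu.
have re_gt0 (e : scalar_field R k) : 0 < e -> 0 < re_scalar e.
  move=> e0; rewrite -(ltr_real_scalar k) ge0_real_scalarK ?ltW//.
  by rewrite real_scalar0.
have ltE (x : V) (e : scalar_field R k) : 0 < e ->
    (`|x| < e) = (rnorm x < re_scalar e).
  move=> e0; rewrite -rnormK -{1}(ge0_real_scalarK (ltW e0)).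
  exact: ltr_real_scalar.
have : cvg (u @ \oo).
  apply/cauchy_cvgP/cauchy_exP => e e0.
  have [N uN] := cu _ (re_gt0 _ e0).
  exists (u N); exists N => // n /= Nn.
  by rewrite -ball_normE /ball_ /= ltE // uN.
move=> /cvg_ex[l /cvgr_dist_lt ul]; exists l => e e0.
have e0' : 0 < real_scalar k e by rewrite -(@real_scalar0 R k) ltr_real_scalar.
have [N _ HN] := ul _ e0'.
exists N => n /HN /=.
by rewrite ltE // real_scalarK.
Qed.
End Complete.

(** * The underlying real Hilbert space *)

Section RealInner.
Context (R : realType) (k : scalar_kind) (H : hilbertType R k).
Implicit Types (x y z h : H) (r : R).

Definition rinner x y : R := re_scalar (inner x y).

Local Notation "r *:r x" := (real_scalar k r *: x) (at level 40).

Lemma inner_conj x y : inner x y = conj_scalar (inner y x).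
Proof.
rewrite (@hermitian_subproof _ _ false (@conj_scalar R k) (@inner R k H)).
by rewrite expr0 mul1r.
Qed.

Lemma rinnerC x y : rinner x y = rinner y x.
Proof. by rewrite /rinner inner_conj re_scalar_conj. Qed.

Lemma rinnerDl x y z : rinner (x + y) z = rinner x z + rinner y z.
Proof. by rewrite /rinner linearDl re_scalarD. Qed.

Lemma rinnerZl r x y : rinner (r *:r x) y = r * rinner x y.
Proof. by rewrite /rinner linearZl_LR /= re_scalarM. Qed.

Lemma rinnerDr x y z : rinner x (y + z) = rinner x y + rinner x z.
Proof. by rewrite rinnerC rinnerDl !(rinnerC _ x). Qed.

Lemma rinnerZr r x y : rinner x (r *:r y) = r * rinner x y.
Proof. by rewrite rinnerC rinnerZl rinnerC. Qed.

Lemma rinnerBl x y z : rinner (x - y) z = rinner x z - rinner y z.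
Proof. by apply/eqP; rewrite eq_sym subr_eq -rinnerDl subrK. Qed.

Lemma rinnerBr x y z : rinner x (y - z) = rinner x y - rinner x z.
Proof. by rewrite rinnerC rinnerBl !(rinnerC _ x). Qed.

Lemma rnorm_sqr x : rnorm x ^+ 2 = rinner x x.
Proof.
rewrite /rinner -normr_inner.
have -> : `|x| = real_scalar k (rnorm x) by rewrite rnormK.
by rewrite [in RHS]expr2 re_scalarM real_scalarK.
Qed.

Lemma rnorm_eq0 x : rnorm x = 0 -> x = 0.
Proof.
by move=> x0; apply/eqP; rewrite -normr_eq0 -rnormK x0 real_scalar0.
Qed.

Lemma rinner_CauchySchwarz x y : `|rinner x y| <= rnorm x * rnorm y.
Proof.
have [x0 y0] := (rnorm_ge0 x, rnorm_ge0 y).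
rewrite -ler_sqr ?nnegrE ?mulr_ge0 // real_normK ?num_real // exprMn !rnorm_sqr.
(* The squared norm of x + r y is a nonnegative quadratic polynomial in r. *)
have q r : 0 <= rinner x x + 2 * r * rinner x y + r ^+ 2 * rinner y y.
  have := sqr_ge0 (rnorm (x + r *:r y)).
  rewrite rnorm_sqr rinnerDl !rinnerDr !rinnerZl !rinnerZr (rinnerC y x).
  by move/le_trans; apply; rewrite le_eqVlt; apply/orP; left; apply/eqP; ring.
have [yy0|yy0] := eqVneq (rinner y y) 0.
  have -> : y = 0.
    by apply: rnorm_eq0; apply/eqP; rewrite -sqrf_eq0 rnorm_sqr yy0.
  by rewrite /rinner !linear0r -(@real_scalar0 R k) !real_scalarK expr0n mulr0.
have yy : 0 < rinner y y by rewrite lt_def yy0 -rnorm_sqr sqr_ge0.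
have := mulr_ge0 (q (- rinner x y / rinner y y)) (ltW yy).
suff -> : (rinner x x + 2 * (- rinner x y / rinner y y) * rinner x y +
   (- rinner x y / rinner y y) ^+ 2 * rinner y y) * rinner y y =
   rinner x x * rinner y y - rinner x y ^+ 2 by rewrite subr_ge0.
by field.
Qed.

(** The representing vector minimizes J x = |x|^2 - 2 phi x: by the
    parallelogram identity a minimizing sequence is Cauchy, and at its limit z
    the first variation 2 (<z, x> - phi x) of J in each direction x vanishes. *)
Theorem riesz (phi : H -> R) (C : R)
    (phiD : forall x y, phi (x + y) = phi x + phi y)
    (phiZ : forall r x, phi (r *:r x) = r * phi x)
    (phiC : forall x, `|phi x| <= C * rnorm x) :
  exists z, forall x, phi x = rinner z x.
Proof.
pose J x := rinner x x - 2 * phi x.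
have Jlb x : - C ^+ 2 <= J x.
  have := sqr_ge0 (rnorm x - C); rewrite sqrrB rnorm_sqr => h.
  have := phiC x; rewrite ler_norml => /andP[_].
  rewrite /J; lra.
pose m := inf (range J).
have hJ : has_inf (range J).
  by split; [exists (J 0), 0 | exists (- C ^+ 2) => _ [x _ <-]].
have mJ x : m <= J x by apply: ge_inf; [case: hJ | exists x].
have /choice[u uJ] n : exists x, J x < m + n.+1%:R^-1.
  have n0 : (0 : R) < n.+1%:R^-1 by rewrite invr_gt0.
  by have [_ [x _ <-] xm] := inf_adherent n0 hJ; exists x.
have inv_lt (e : R) : 0 < e ->
    exists N, forall n, (N <= n)%N -> n.+1%:R^-1 < e.
  move=> e0; exists (Num.truncn e^-1) => n Nn.
  rewrite -ltf_pV2 ?posrE // invrK (lt_le_trans (truncnS_gt _)) //.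
  by rewrite ler_nat ltnS.
(* The parallelogram identity in the form
   |x - y|^2 = 2 (J x + J y - 2 J ((x + y) / 2)). *)
have near_min i j : rnorm (u i - u j) ^+ 2 <= 2 * (i.+1%:R^-1 + j.+1%:R^-1).
  have := mJ (2^-1 *:r (u i + u j)); have := uJ i; have := uJ j.
  rewrite /J rnorm_sqr rinnerBl !rinnerBr rinnerZl rinnerZr.
  rewrite !rinnerDl !rinnerDr phiZ phiD (rinnerC (u j) (u i)).
  move: (i.+1%:R^-1) (j.+1%:R^-1) => ei ej; lra.
have [z uz] : exists z, forall e : R, 0 < e ->
    exists N, forall n, (N <= n)%N -> rnorm (z - u n) < e.
  apply: rnorm_complete => e e0.
  have [N HN] := inv_lt (e ^+ 2 / 4) ltac:(by rewrite divr_gt0 ?exprn_gt0).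
  exists N => i j Ni Nj.
  rewrite -ltr_sqr ?nnegrE ?rnorm_ge0 ?(ltW e0) //.
  apply: le_lt_trans (near_min i j) _.
  have := HN i Ni; have := HN j Nj.
  by move: (i.+1%:R^-1) (j.+1%:R^-1) => ei ej; lra.
exists z => x; apply/eqP; rewrite eq_sym -subr_eq0 -normr_le0.
(* The bound is proved with a slack e: at accuracy d the error is at most d K. *)
pose K := (1 + rnorm x) ^+ 2.
have K0 : 0 < K by rewrite exprn_gt0 // ltr_wpDr ?rnorm_ge0.
apply/ler_addgt0Pr => e e0; rewrite add0r.
pose d := e / K; have d0 : 0 < d by rewrite divr_gt0.
have [N1 HN1] := uz _ d0; have [N2 HN2] := inv_lt _ (exprn_gt0 2 d0).
pose n := maxn N1 N2.
have zun : `|rinner (z - u n) x| <= d * rnorm x.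
  apply: le_trans (rinner_CauchySchwarz _ _) _.
  by rewrite ler_wpM2r ?rnorm_ge0 // ltW // HN1 // leq_maxl.
(* J cannot drop by d^2 or more along the line from u n in the direction x,
   so the linear coefficient of this quadratic polynomial is small. *)
have q r :
    0 <= d ^+ 2 + 2 * r * (rinner (u n) x - phi x) + r ^+ 2 * rnorm x ^+ 2.
  have := mJ (u n + r *:r x); have := uJ n.
  have := HN2 n (leq_maxr _ _); move: (n.+1%:R^-1) => en; rewrite /J.
  rewrite rinnerDl !rinnerDr !rinnerZl !rinnerZr phiD phiZ (rinnerC x (u n)).
  rewrite rnorm_sqr; lra.
have bn : `|rinner (u n) x - phi x| <= d * (1 + rnorm x ^+ 2) / 2.
  rewrite ler_norml; apply/andP; split.
    rewrite -(ler_pM2l d0); have := q d; nra.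
  rewrite -(ler_pM2l d0); have := q (- d); nra.
have -> : rinner z x - phi x = rinner (z - u n) x + (rinner (u n) x - phi x).
  by rewrite rinnerBl; ring.
apply: le_trans (ler_normD _ _) _.
have -> : e = d * K by rewrite /d divfK // gt_eqF.
by have := rnorm_ge0 x; rewrite /K; nra.
Qed.

End RealInner.

(** * The uniform boundedness principle *)

Section UniformBoundedness.
Context (R : realType) (k : scalar_kind) (H : hilbertType R k).
Implicit Types (x y z h : H) (r : R).
Local Notation "r *:r x" := (real_scalar k r *: x) (at level 40).

(** Moving from x by r along h, in the direction whose sign agrees with <x, h>,
    makes the modulus of the pairing with h at least r |h|, whatever x is. *)
Lemma exists_step x h r : 0 <= r ->
  exists y, rnorm (y - x) <= r /\ r * rnorm h <= `|rinner y h|.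
Proof.
move=> r0; have [h0|h0] := eqVneq (rnorm h) 0.
  by exists x; rewrite subrr h0 mulr0 rnorm0.
have hp : 0 < rnorm h by rewrite lt_def h0 rnorm_ge0.
pose s : R := if 0 <= rinner x h then 1 else -1.
have sE : `|s| = 1 by rewrite /s; case: ifP; rewrite ?normrN normr1.
exists (x + (s * (r / rnorm h)) *:r h); split.
  rewrite addrC addKr rnormZ !normrM sE mul1r normfV.
  by rewrite (ger0_norm (ltW hp)) divfK // ger0_norm.
rewrite rinnerDl rinnerZl -rnorm_sqr.
have -> : s * (r / rnorm h) * rnorm h ^+ 2 = s * (r * rnorm h).
  by rewrite expr2 mulrA -(mulrA s) divfK // mulrA.
have rh : 0 <= r * rnorm h by rewrite mulr_ge0 // ltW.
rewrite ler_normr /s.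
case: (leP 0 (rinner x h)) => xh; apply/orP; [left|right]; lra.
Qed.

(** A gliding hump without Baire's theorem: if E contains very long vectors g n,
    steps of length 3^-(n+1) along g n produce a point x whose pairing with g n
    is still of order 3^-(n+1) |g n|, because the later steps add up to at most
    half of the n-th one; then <x, g n> is unbounded. *)
Theorem uniform_boundedness (E : set H) :
  (forall x, exists M, forall h, E h -> `|rinner x h| <= M) ->
  exists C, 0 < C /\ forall h, E h -> rnorm h <= C.
Proof.
move=> bE; apply: contrapT => /forallNP nE.
(* The factor 2 * 3 ^+ n.+1 makes up for the n-th step, of which half may be
   lost, so that the pairing of the limit with g n is at least n. *)
have /choice[g gP] n : exists h, E h /\ 2 * 3 ^+ n.+1 * n%:R <= rnorm h.
  apply: contrapT => /forallNP nh.
  apply: (nE (2 * 3 ^+ n.+1 * n%:R + 1)); split.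
    by rewrite ltr_wpDl // !mulr_ge0.
  move=> h Eh; have [//|lth] := leP (rnorm h) _.
  by case: (nh h); split => //; apply/ltW/le_lt_trans/lth; rewrite lerDl.
pose e n : R := 3^-1 ^+ n.
have e0 n : 0 < e n by rewrite exprn_gt0 // invr_gt0.
have eS n : e n = 3 * e n.+1 by rewrite /e exprS mulrA divff // mul1r.
have /choice[F FP] (p : nat * H) : exists y, rnorm (y - p.2) <= e p.1.+1 /\
    e p.1.+1 * rnorm (g p.1) <= `|rinner y (g p.1)|.
  exact/exists_step/ltW.
pose u := fix u n := if n is n'.+1 then F (n', u n') else 0.
have uS n : rnorm (u n.+1 - u n) <= e n.+1 by have [] := FP (n, u n).
have ug n : e n.+1 * rnorm (g n) <= `|rinner (u n.+1) (g n)|.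
  by have [] := FP (n, u n).
have u_tail n d : rnorm (u (n + d)%N - u n) <= (e n - e (n + d)%N) / 2.
  elim: d => [|d IH].
    by rewrite addn0 !subrr mul0r rnorm0.
  rewrite addnS -(subrK (u (n + d)%N) (u _.+1)) -addrA.
  apply: le_trans (rnormD _ _) _.
  have := uS (n + d)%N; have := eS (n + d)%N; lra.
have u_tail2 n m : (n <= m)%N -> rnorm (u m - u n) <= e n / 2.
  move=> nm; rewrite -(subnKC nm); apply: le_trans (u_tail _ _) _.
  by have := e0 (n + (m - n))%N; lra.
have e_small (d : R) : 0 < d -> exists N, e N < d.
  move=> d0; exists (Num.truncn d^-1).
  rewrite /e exprVn -ltf_pV2 ?posrE ?invr_gt0 ?exprn_gt0 // invrK.
  apply: lt_le_trans (truncnS_gt _) _.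
  by rewrite -natrX ler_nat ltn_expl.
have [x ux] : exists x, forall e : R, 0 < e ->
    exists N, forall n, (N <= n)%N -> rnorm (x - u n) < e.
  apply: rnorm_complete => d d0.
  have [N HN] := e_small _ d0.
  exists N => m n Nm Nn.
  rewrite -(subrK (u N) (u m)) -addrA; apply: le_lt_trans (rnormD _ _) _.
  by have := u_tail2 _ _ Nm; have := u_tail2 _ _ Nn; rewrite rdistC; lra.
have xu n : rnorm (x - u n) <= e n / 2.
  apply/ler_addgt0Pr => d d0; have [N HN] := ux _ d0.
  rewrite -(subrK (u (maxn N n)) x) -addrA; apply: le_trans (rnormD _ _) _.
  have := HN _ (leq_maxl N n); have := u_tail2 _ _ (leq_maxr N n); lra.
have [M HM] := bE x.
pose n := (Num.truncn M).+1.
have [Eg gn] := gP n.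
have : n%:R <= `|rinner x (g n)|.
  have : `|rinner (u n.+1 - x) (g n)| <= e n.+1 / 2 * rnorm (g n).
    apply: le_trans (rinner_CauchySchwarz _ _) _.
    by rewrite ler_wpM2r ?rnorm_ge0 // rdistC.
  have : `|rinner (u n.+1) (g n)| <=
      `|rinner (u n.+1 - x) (g n)| + `|rinner x (g n)|.
    by rewrite -[in leLHS](subrK x (u n.+1)) rinnerDl ler_normD.
  have := ug n.
  have : e n.+1 / 2 * (2 * 3 ^+ n.+1 * n%:R) <= e n.+1 / 2 * rnorm (g n).
    by rewrite ler_wpM2l // divr_ge0 // ltW.
  have -> : e n.+1 / 2 * (2 * 3 ^+ n.+1 * n%:R) = n%:R.
    by rewrite /e exprVn; field; rewrite expf_neq0.
  lra.
by apply/negP; rewrite -ltNge; apply: le_lt_trans (HM _ Eg) (truncnS_gt _).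
Qed.

End UniformBoundedness.

(** * Adjoint operators *)

Section Adjoint.
Context (R : realType) (k : scalar_kind) (H : hilbertType R k).
Implicit Types (x y z h : H) (r : R).

Local Notation "r *:r x" := (real_scalar k r *: x) (at level 40).

(** Replacing v by a scalar multiple c v turns the real part of a v - b v into
    that of conj c (a v - b v), and c = a v - b v gives its squared modulus. *)
Lemma conj_linear_re_inj (V : lmodType (scalar_field R k))
    (a b : V -> scalar_field R k)
    (aZ : forall c v, a (c *: v) = conj_scalar c * a v)
    (bZ : forall c v, b (c *: v) = conj_scalar c * b v) :
  (forall v, re_scalar (a v) = re_scalar (b v)) -> a =1 b.
Proof.
move=> ab v; apply/eqP; rewrite -subr_eq0; apply/eqP/re_mul_conj_eq0.
by rewrite mulrBr -aZ -bZ re_scalarB ab subrr.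
Qed.

Lemma adjoint_exists (T : {linear H -> H}) (Tb : bounded_operator T) :
  exists S : H -> H, forall h x, inner h (T x) = inner (S h) x.
Proof.
suff /choice[S HS] h : exists z, forall x, inner h (T x) = inner z x.
  by exists S.
have [M TM] := Tb.
have [||x|z hz] := @riesz R k H (fun x => rinner h (T x)) (rnorm h * M).
- by move=> x y; rewrite raddfD rinnerDr.
- by move=> r x; rewrite linearZ rinnerZr.
- apply: le_trans (rinner_CauchySchwarz _ _) _.
  by rewrite -mulrA ler_wpM2l ?rnorm_ge0.
exists z.
apply: (conj_linear_re_inj (a := fun x => inner h (T x))) => [c x|c x|x].
- by rewrite linearZ linearZr_LR.
- by rewrite linearZr_LR.
- exact: hz.
Qed.

Section AdjointBounds.
Context (T : {linear H -> H}) (S : H -> H)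
        (adjS : forall h x, inner h (T x) = inner (S h) x).

(** The square |S h|^2 = <h, T (S h)> is at most |h| M |S h|. *)
Lemma adjoint_le (M : R) (TM : forall x, rnorm (T x) <= M * rnorm x) h :
  rnorm (S h) <= M * rnorm h.
Proof.
have [S0|S0] := eqVneq (rnorm (S h)) 0.
  (* The sign of M is unknown here, but 0 <= |T h| <= M |h|. *)
  rewrite S0; have [h0|h0] := eqVneq (rnorm h) 0; first by rewrite h0 mulr0.
  have hp : 0 < rnorm h by rewrite lt_def h0 rnorm_ge0.
  exact: le_trans (rnorm_ge0 _) (TM h).
have Sp : 0 < rnorm (S h) by rewrite lt_def S0 rnorm_ge0.
rewrite -(ler_pM2r Sp) -expr2 rnorm_sqr.
have -> : rinner (S h) (S h) = rinner h (T (S h)) by rewrite /rinner adjS.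
apply: le_trans (ler_norm _) _; apply: le_trans (rinner_CauchySchwarz _ _) _.
by rewrite [leRHS]mulrAC mulrC ler_wpM2r ?rnorm_ge0.
Qed.

(** Dual to the open mapping theorem: the adjoint of a surjective operator is
    bounded below. *)
Lemma adjoint_bounded_below (Tsurj : forall y, exists x, T x = y) :
  exists C, 0 < C /\ forall h, rnorm h <= C * rnorm (S h).
Proof.
(* The vectors y with |S y| <= 1, parametrized as rescalings y = a h of
   arbitrary vectors h. *)
pose E : set H := [set y | exists h a, y = a *:r h /\ `|a| * rnorm (S h) <= 1].
have [|C [C0 HC]] := @uniform_boundedness R k H E.
  move=> y; have [x <-] := Tsurj y; exists (rnorm x) => _ [h [a [-> ah]]].
  rewrite rinnerZr rinnerC /rinner adjS normrM.
  apply: le_trans (ler_wpM2l (normr_ge0 a) (rinner_CauchySchwarz (S h) x)) _.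
  by rewrite mulrA ler_piMl ?rnorm_ge0.
(* The slack e / C allows normalizing by d also when S h = 0. *)
exists C; split=> // h; apply/ler_addgt0Pr => e e0.
pose d := rnorm (S h) + e / C.
have d0 : 0 < d by rewrite ltr_wpDl ?rnorm_ge0 // divr_gt0.
have -> : C * rnorm (S h) + e = C * d.
  by rewrite mulrDr [in RHS]mulrCA divff ?gt_eqF // mulr1.
rewrite -ler_pdivrMr // mulrC -(@ger0_norm _ d^-1) ?invr_ge0 ?(ltW d0) //.
rewrite -rnormZ; apply: HC; exists h, d^-1; split=> //.
rewrite ger0_norm ?invr_ge0 ?(ltW d0) // mulrC ler_pdivrMr // mul1r.
by rewrite lerDl divr_ge0 // ltW.
Qed.
End AdjointBounds.

End Adjoint.

(** * Images of frames *)

Lemma frame_image (R : realType) (k : scalar_kind) (H : hilbertType R k)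
    (I : countType) (f : I -> H) (T : {linear H -> H})
    (Tb : bounded_operator T) (Tsurj : forall y, exists x, T x = y) :
  frame f -> frame (T \o f).
Proof.
move=> [A [B [A0 B0 AB]]].
have [S adjS] := adjoint_exists Tb; have [M TM] := Tb.
have [C [C0 SC]] := adjoint_bounded_below adjS Tsurj.
exists (A / C ^+ 2), (B * (`|M| + 1) ^+ 2); split.
- by rewrite divr_gt0 ?exprn_gt0.
- by rewrite mulr_gt0 ?exprn_gt0 ?ltr_wpDl.
move=> h; under eq_esum do rewrite /= adjS.
have /andP[lo up] := AB (S h); apply/andP; split.
- apply: le_trans lo; rewrite lee_fin -mulrA ler_pM2l //.
  rewrite mulrC ler_pdivrMr ?exprn_gt0 // -exprMn mulrC.
  by rewrite ler_sqr ?nnegrE ?mulr_ge0 ?rnorm_ge0 ?(ltW C0).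
- apply: le_trans up _; rewrite lee_fin -mulrA ler_pM2l // -exprMn.
  rewrite ler_sqr ?nnegrE ?mulr_ge0 ?rnorm_ge0 ?addr_ge0 //.
  apply: le_trans (adjoint_le adjS TM h) _.
  rewrite ler_wpM2r ?rnorm_ge0 //.
  by apply: le_trans (ler_norm _) _; rewrite lerDl.
Qed.

Theorem proposition3p9 (R : realType) (k : scalar_kind) (H : hilbertType R k)
  (sepH : separable H) (I : countType) (f g : I -> H) (wfg : woven f g)
  (T : {linear H -> H}) (Tbounded : bounded_operator T)
  (Tinvertible : bijective T) :
  woven (T \o f) (T \o g).
Proof.
have [T' _ TT'] := Tinvertible.
have Tsurj y : exists x, T x = y by exists (T' y); rewrite TT'.
have [ff fg fw] := wfg; split=> [||sigma].
- exact: frame_image.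
- exact: frame_image.
have -> : weaving (T \o f) (T \o g) sigma = T \o weaving f g sigma.
  by apply/funext => i; rewrite /weaving /=; case: ifP.
exact: frame_image.
Qed.
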